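(* Let $0<\alpha<1$, $\mu>-1$ and $t>0$. The $\mathcal{V}$-fractional integral of order $\alpha$ with $a=0$ of the function $x\mapsto (t-x)^{\mu}$, $0<x<t$, satisfies $${}_{0}^{\rho}\mathcal{I}_{\gamma,\beta,\alpha}^{\delta,p,q}(t-x)^{\mu}=\frac{\Gamma(\gamma+\beta)\,\Gamma(\alpha)\,(\delta)_p}{\Gamma(\beta)\,(\rho)_q}\,J^{\alpha}t^{\mu},$$ where $J^{\alpha}t^{\mu}$ is the Riemann-Liouville fractional integral of order $\alpha$ of the function $s\mapsto s^\mu$, evaluated at $t$.
   Context: Parameters: $\gamma,\beta,\rho,\delta\in\mathbb{C}$ with $\mathrm{Re}(\gamma),\mathrm{Re}(\beta),\mathrm{Re}(\rho),\mathrm{Re}(\delta)>0$ and real $p,q>0$ with $\mathrm{Re}(\gamma)+p\ge q$. For real $s\ge 0$, $(z)_s:=\Gamma(z+s)/\Gamma(z)$. The left-hand side means, with $x$ the integration variable and $t$ fixed, $${}_{0}^{\rho}\mathcal{I}_{\gamma,\beta,\alpha}^{\delta,p,q}(t-x)^{\mu}=\frac{\Gamma(\gamma+\beta)(\delta)_p}{\Gamma(\beta)(\rho)_q}\int_0^t\frac{(t-x)^\mu}{x^{1-\alpha}}\,dx.$$ The Riemann-Liouville fractional integral is $J^{\alpha}h(t)=\frac{1}{\Gamma(\alpha)}\int_0^t (t-s)^{\alpha-1}h(s)\,ds$. *)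

(* Defs.v *)
From HB Require Import structures.
From mathcomp Require Import all_boot all_order all_algebra.
From mathcomp Require Import complex.
From mathcomp Require Import all_classical all_reals all_analysis.

Set Implicit Arguments.
Unset Strict Implicit.
Unset Printing Implicit Defensive.

Import Order.TTheory GRing.Theory Num.Theory.
Import numFieldNormedType.Exports.

Local Open Scope classical_set_scope.
Local Open Scope ring_scope.
Local Open Scope complex_scope.

Section VFractional.
Context {R : realType}.
Local Notation mu := (@lebesgue_measure R).

Definition cexp (z : R[i]) : R[i] :=
  (expR (complex.Re z) * cos (complex.Im z))
    +i* (expR (complex.Re z) * sin (complex.Im z)).

(* Principal value; meaningful for 0 < x only. *)
Definition cpow (x : R) (z : R[i]) : R[i] := cexp (z * (ln x)%:C).

Definition cintegral (D : set R) (f : R -> R[i]) : R[i] :=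
  (\int[mu]_(x in D) complex.Re (f x)) +i* (\int[mu]_(x in D) complex.Im (f x)).

(* Euler's integral, which converges (absolutely) exactly when 0 < Re z;
   no meromorphic continuation to the other z is attempted. *)
Definition Gamma (z : R[i]) : R[i] :=
  cintegral `]0, +oo[ (fun x => cpow x (z - 1) * (expR (- x))%:C).

Definition pochhammer (z : R[i]) (s : R) : R[i] := Gamma (z + s%:C) / Gamma z.

(* The integrands below may be singular at both endpoints, hence the open
   intervals. The integrals are Lebesgue integrals, and [Rintegral] need not be
   the true value when the integrand is not integrable: the two [_integrable]
   predicates state that it is. *)
Definition V_integrand (alpha : R) (f : R -> R) (x : R) : R :=
  f x / x `^ (1 - alpha).

Definition V_integrable (a alpha : R) (f : R -> R) (t : R) : Prop :=
  mu.-integrable `]a, t[ (EFin \o V_integrand alpha f).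

Definition V_integral (gamma beta rho delta : R[i]) (p q : R)
    (a alpha : R) (f : R -> R) (t : R) : R[i] :=
  Gamma (gamma + beta) * pochhammer delta p / (Gamma beta * pochhammer rho q)
  * (\int[mu]_(x in `]a, t[) V_integrand alpha f x)%:C.

Definition RL_integrand (alpha : R) (h : R -> R) (t s : R) : R :=
  (t - s) `^ (alpha - 1) * h s.

Definition RL_integrable (alpha : R) (h : R -> R) (t : R) : Prop :=
  mu.-integrable `]0, t[ (EFin \o RL_integrand alpha h t).

(* Complex-valued only because [Gamma] is. *)
Definition RL_integral (alpha : R) (h : R -> R) (t : R) : R[i] :=
  (Gamma alpha%:C)^-1 * (\int[mu]_(s in `]0, t[) RL_integrand alpha h t s)%:C.

End VFractional.

(* Main.v *)
(* The reflection x = t - s preserves Lebesgue measure and turns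
   (t - x)^mu / x^(1 - alpha) into the Riemann-Liouville integrand, so the two
   integrals agree; both converge since alpha - 1 > -1 and mu > -1. The constants
   match because Gamma(alpha) cancels: it is nonzero, being the integral of a
   positive function. Integrability of that function has to be checked as well,
   since the Lebesgue integral of a function with infinite integral is 0 here. *)

Require Import Defs.
From HB Require Import structures.
From mathcomp Require Import all_boot all_order all_algebra.
From mathcomp Require Import complex.
From mathcomp Require Import all_classical all_reals all_analysis.
From mathcomp Require Import measurable_realfun lra.

Set Implicit Arguments.
Unset Strict Implicit.
Unset Printing Implicit Defensive.

Import Order.TTheory GRing.Theory Num.Theory.
Import numFieldNormedType.Exports.

Local Open Scope classical_set_scope.
Local Open Scope ring_scope.
Local Open Scope complex_scope.

Section PowerIntegrals.
Context {R : realType}.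
Local Notation leb := (@lebesgue_measure R).
Implicit Types (a c t : R).

(** * Nonnegative integrands and the reflection of an interval *)

Lemma ge0_integrable_lty d (T : measurableType d) (m : {measure set T -> \bar R})
    (D : set T) (f : T -> R) :
  measurable_fun D f -> (forall x, D x -> 0 <= f x) ->
  (\int[m]_(x in D) (f x)%:E < +oo)%E -> m.-integrable D (EFin \o f).
Proof.
move=> mf f0 foo; apply/integrableP; split; first exact/measurable_EFinP.
apply: le_lt_trans foo; rewrite le_eqVlt; apply/orP; left; apply/eqP.
by apply: eq_integral => x /set_mem Dx; rewrite /= ger0_norm// f0.
Qed.

(** The pushforward of Lebesgue measure under [x |-> t - x] is Lebesgue measure again. No finite
    integral is assumed, so integrability itself can be carried across the reflection. *)
Lemma ge0_integral_reflection t (f : R -> \bar R) :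
  measurable_fun setT f -> (forall x, 0 <= f x)%E ->
  (\int[leb]_(x in `]0%R, t[) f x = \int[leb]_(x in `]0%R, t[) f (t - x)%R)%E.
Proof.
move=> mf f0.
pose phi : measurableTypeR R -> measurableTypeR R := fun x => t - x.
have mphi : measurable_fun setT phi by exact: measurable_funB.
have phi_itv : phi @^-1` `]0, t[%classic = `]0, t[%classic.
  by apply/seteqP; split => x; rewrite /phi /= !in_itv /=; lra.
rewrite -[X in (_ = integral _ X _)%E]phi_itv.
rewrite -[RHS](@ge0_integral_pushforward _ _ _ _ R phi mphi leb `]0, t[%classic f)//;
  last exact: measurable_funS mf.
apply: eq_measure_integral => //= A mA _; apply: lebesgue_measure_unique => //.
move=> _ [[a b]] _ <-; rewrite /pushforward.
transitivity (leb (phi @^-1` `]a, b]%classic)); last by [].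
(* The reflection swaps the closed and the open end; the length stays [b - a], which is all that
   uniqueness of the measure asks for. *)
have -> : phi @^-1` `]a, b]%classic = `[t - b, t - a[%classic.
  by apply/seteqP; split => x; rewrite /phi /= !in_itv /=; lra.
rewrite !lebesgue_measure_itv/= !lte_fin ltrD2l ltrN2.
by case: ifP => // _; congr EFin; lra.
Qed.

(** * Integrability of powers and of their products *)

Lemma continuous_powR a x : 0 < x -> {for x, continuous (@powR R ^~ a)}.
Proof.
move=> x0; apply/differentiable_continuous/derivable1_diffP.
by apply: derivable_powR; rewrite in_itv/= x0.
Qed.

(** Fundamental theorem of calculus with the primitive [x^(a+1) / (a+1)]. Its value at [u] is
    nonnegative and is dropped, so the bound is uniform as [u] tends to 0. *)
Lemma integral_powR_le a (u c : R) : -1 < a -> 0 < u -> u < c ->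
  (\int[leb]_(x in `[u, c]) (x `^ a)%:E <= ((a + 1)^-1 * c `^ (a + 1))%:E)%E.
Proof.
move=> a1 u0 uc.
have a0 : 0 < a + 1 by rewrite -ltrBlDr sub0r.
pose F x := (a + 1)^-1 * x `^ (a + 1).
have cF x : 0 < x -> {for x, continuous F}.
  move=> x0; apply: (@continuousM R R^o) => //; first exact: cst_continuous.
  exact: continuous_powR.
rewrite (@continuous_FTC2 _ _ F)//.
- rewrite -EFinB lee_fin lerBlDr lerDl mulr_ge0 ?invr_ge0 ?powR_ge0 ?ltW//.
- apply: continuous_in_subspaceT => x; rewrite inE/= in_itv/= => /andP[ux _].
  by apply: continuous_powR; exact: lt_le_trans ux.
- split.
  + move=> x; rewrite in_itv/= => /andP[ux _].
    apply: derivableM => //; apply: derivable_powR.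
    by rewrite in_itv/= (lt_trans u0 ux).
  + by apply/cvg_at_right_filter/cF.
  + by apply/cvg_at_left_filter/cF/(lt_trans u0).
- move=> x; rewrite in_itv/= => /andP[ux _].
  have x0 : 0 < x by exact: lt_trans ux.
  rewrite derive1E deriveZ/=; last by apply: derivable_powR; rewrite in_itv/= x0.
  rewrite -derive1E powR_derive1 ?in_itv/= ?x0// addrK.
  by rewrite /GRing.scale/= mulrA mulVf ?mul1r// gt_eqF.
Qed.

(** Monotone convergence along the intervals [[1/(n+1), c]], which exhaust []0, c]] and avoid the
    singularity. *)
Lemma integrable_powR a c : -1 < a -> 0 < c ->
  leb.-integrable `]0, c] (EFin \o (@powR R ^~ a)).
Proof.
move=> a1 c0; apply: ge0_integrable_lty.
- by apply: measurable_funTS; exact: measurable_powR.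
- by move=> x _; exact: powR_ge0.
have nd : nondecreasing_seq (fun n : nat => `[n.+1%:R^-1, c]%classic : set R).
  move=> m n mn; apply/subsetPset/subset_itvr; rewrite bnd_simp.
  rewrite lef_pV2 ?posrE// ?ler_nat ?ltr0n//.
have cvgI : (\int[leb]_(x in `[n.+1%:R^-1%R, c]) (x `^ a)%:E @[n --> \oo] -->
    \int[leb]_(x in `]0%R, c]) (x `^ a)%:E)%E.
  have -> : `]0, c]%classic = \bigcup_n `[n.+1%:R^-1, c]%classic :> set R.
    by rewrite itv_open_bnd_bigcup; apply: eq_bigcupr => n _; rewrite add0r.
  apply: ge0_nondecreasing_set_cvg_integral => // n.
    by apply/measurable_EFinP; apply: measurable_funTS; exact: measurable_powR.
  by move=> x _; rewrite lee_fin powR_ge0.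
apply: (@le_lt_trans _ _ ((a + 1)^-1 * c `^ (a + 1))%:E); last exact: ltry.
rewrite -(cvg_lim _ cvgI)//; apply: lime_le.
  by apply/cvg_ex; eexists; exact: cvgI.
near=> n; apply: integral_powR_le => //.
by near: n; exact: near_infty_natSinv_lt (PosNum c0).
Unshelve. all: by end_near. Qed.

(** A power is monotone in its base, in a direction set by the sign of [a]; the sum of both endpoint
    values covers the two cases at once. *)
Lemma powR_le_endpoints a (u v x : R) : 0 < u -> u <= x <= v ->
  x `^ a <= u `^ a + v `^ a.
Proof.
move=> u0 /andP[ux xv].
have x0 : 0 < x by exact: lt_le_trans ux.
have v0 : 0 < v by exact: lt_le_trans xv.
have [a0|a0] := leP 0 a.
  apply: (@le_trans _ _ (v `^ a)); last by rewrite lerDr powR_ge0.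
  by rewrite ge0_ler_powR// nnegrE ltW.
rewrite -(opprK a) ![_ `^ - - a]powRN.
apply: (@le_trans _ _ ((u `^ (- a))^-1)); last by rewrite lerDl invr_ge0 powR_ge0.
rewrite lef_pV2 ?posrE ?powR_gt0// ge0_ler_powR// ?nnegrE ?(ltW u0) ?(ltW x0)//.
by rewrite oppr_ge0 ltW.
Qed.

(** Serves both integrands of the theorem: exponents [(alpha - 1, mu)] give the Riemann-Liouville
    one, [(mu, alpha - 1)] the other. *)
Lemma integrable_powRM a b t : -1 < a -> -1 < b -> 0 < t ->
  leb.-integrable `]0, t[ (EFin \o (fun s => (t - s) `^ a * s `^ b)).
Proof.
move=> a1 b1 t0.
have mpow e : measurable_fun setT (@powR R ^~ e) by exact: measurable_powR.
have mrefl e : measurable_fun setT (fun s : R => (t - s) `^ e).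
  by apply: (measurableT_comp (mpow e)); exact: measurable_funB.
have ipow e : -1 < e -> leb.-integrable `]0, t[ (EFin \o (@powR R ^~ e)).
  move=> e1; apply: integrableS (integrable_powR e1 t0) => //.
  by apply: subset_itvl; rewrite bnd_simp.
have irefl e : -1 < e ->
      leb.-integrable `]0, t[ (EFin \o (fun s => (t - s) `^ e)).
  move=> e1; apply: ge0_integrable_lty.
  - by apply: measurable_funTS; exact: mrefl.
  - by move=> x _; exact: powR_ge0.
  rewrite -(@ge0_integral_reflection t (fun x => (x `^ e)%:E)).
  - by apply: integrable_lty => //; exact: ipow.
  - exact/measurable_EFinP.
  - by move=> x; rewrite lee_fin powR_ge0.
(* [K e] bounds a power with exponent [e] whose base lies in [[t/2, t]]: the base is [t - s] on the
   left half and [s] on the right half. *)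
pose K e := (t / 2) `^ e + t `^ e.
have K0 e : 0 <= K e by rewrite addr_ge0 ?powR_ge0.
(* At most one of the two factors is singular on each half of the interval. *)
have I : leb.-integrable `]0, t[
    (fun s => ((K a)%:E * (s `^ b)%:E + (K b)%:E * ((t - s) `^ a)%:E)%E).
  apply: integrableD => //; apply: integrableZl => //; [exact: ipow|exact: irefl].
apply: le_integrable I => //.
  by apply/measurable_EFinP; apply: measurable_funTS; apply: measurable_funM;
    [exact: mrefl|exact: mpow].
move=> s /=; rewrite in_itv/= => /andP[s0 st].
rewrite lee_fin !ger0_norm ?addr_ge0 ?mulr_ge0 ?powR_ge0//.
have [st2|st2] := leP s (t / 2).
  rewrite -[leLHS]addr0 lerD ?mulr_ge0 ?powR_ge0// ler_wpM2r ?powR_ge0//.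
  by apply: powR_le_endpoints; lra.
rewrite -[leLHS]add0r lerD ?mulr_ge0 ?powR_ge0// mulrC ler_wpM2r ?powR_ge0//.
by apply: powR_le_endpoints; lra.
Qed.

(** * Euler's integral at real arguments *)

(** Domination by [x^(a-1)] on []0, 1]] and, since [a <= 1] makes that power at most 1 beyond 1, by
    the exponential density of rate 1. *)
Lemma integrable_Gamma_integrand a : 0 < a <= 1 ->
  leb.-integrable `]0, +oo[ (EFin \o (fun x => x `^ (a - 1) * expR (- x))).
Proof.
move=> /andP[a0 a1].
have I1 : leb.-integrable `]0, +oo[ ((EFin \o (@powR R ^~ (a - 1))) \_ `]0, 1]).
  apply: (@integrableS _ _ _ _ setT) => //.
  by rewrite -integrable_mkcond//; apply: integrable_powR => //; lra.
have I2 : leb.-integrable `]0, +oo[ (EFin \o exponential_pdf 1).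
  apply: (@integrableS _ _ _ _ setT) => //.
  exact: integrable_exponential_pdf.
apply: le_integrable (integrableD _ I1 I2) => //.
  apply/measurable_EFinP; apply: measurable_funTS; apply: measurable_funM.
    exact: measurable_powR.
  by apply: measurableT_comp.
move=> x /=; rewrite in_itv/= andbT => x0.
rewrite exponential_pdfE ?(ltW x0)// mul1r mulN1r patchE.
rewrite [`|_ * _|]ger0_norm ?mulr_ge0 ?powR_ge0 ?expR_ge0//.
have e1 : expR (- x) <= 1 by rewrite -expR0 ler_expR oppr_le0 ltW.
case: ifPn => [_|].
  rewrite /= lee_fin ger0_norm ?addr_ge0 ?powR_ge0 ?expR_ge0//.
  apply: (@le_trans _ _ (x `^ (a - 1))); last by rewrite lerDl expR_ge0.
  by rewrite ler_piMr ?powR_ge0.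
rewrite notin_setE/= in_itv/= x0/= => /negP; rewrite -ltNge => x1.
rewrite add0r lee_fin ger0_norm ?expR_ge0// ler_piMl ?expR_ge0//.
by rewrite -[leRHS](powRr0 x) ler_powR ?(ltW x1)// subr_le0.
Qed.

Lemma Re_Gamma a :
  complex.Re (Gamma a%:C) =
  (\int[leb]_(x in `]0%R, +oo[) (x `^ (a - 1) * expR (- x)))%R.
Proof.
apply: eq_Rintegral => x; rewrite inE/= in_itv/= andbT => x0.
rewrite !(subr0, mulr0, mul0r, addr0, oppr0, cos0, mulr1).
by rewrite /powR gt_eqF.
Qed.

Lemma Re_Gamma_gt0 a : 0 < a <= 1 -> 0 < complex.Re (Gamma a%:C).
Proof.
move=> a01; have Ig := integrable_Gamma_integrand a01.
have /andP[a0 a1] := a01.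
rewrite Re_Gamma; apply: fine_gt0; apply/andP; split; last exact: integrable_lty.
(* On []0, 1[] the power is at least 1 and the exponential at least [expR (-1)], which gives a
   positive lower bound. *)
apply: (@lt_le_trans _ _ (\int[leb]_(x in `]0%R, 1%R[) (expR (-1))%:E)%E).
  rewrite integral_cst//= lebesgue_measure_itv/= lte_fin ltr01 oppr0 adde0 mule1.
  by rewrite lte_fin expR_gt0.
have mg := measurable_int _ Ig.
apply: (@le_trans _ _ (\int[leb]_(x in `]0%R, 1%R[) (x `^ (a - 1) * expR (- x))%:E)%E).
  apply: ge0_le_integral => //.
  - by apply: measurable_funS mg => //; apply: subset_itvl; rewrite bnd_simp.
  - move=> x /=; rewrite in_itv/= => /andP[x0 x1].
    rewrite lee_fin -[leLHS]mul1r ler_pM ?expR_ge0//.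
      by rewrite -[leLHS](powRr0 x) ger_powR ?x0 ?(ltW x1)// subr_le0.
    by rewrite ler_expR lerN2 ltW.
apply: ge0_subset_integral => //.
- by move=> x _; rewrite lee_fin mulr_ge0 ?powR_ge0 ?expR_ge0.
- by apply: subset_itvl; rewrite bnd_simp.
Qed.

End PowerIntegrals.

Theorem theorem20 (R : realType) (gamma beta rho delta : R[i])
    (p q alpha mu t : R)
    (hgamma : 0 < complex.Re gamma) (hbeta : 0 < complex.Re beta)
    (hrho : 0 < complex.Re rho) (hdelta : 0 < complex.Re delta)
    (hp : 0 < p) (hq : 0 < q) (hpq : q <= complex.Re gamma + p)
    (halpha0 : 0 < alpha) (halpha1 : alpha < 1) (hmu : -1 < mu) (ht : 0 < t) :
  [/\ V_integrable 0 alpha (fun x : R => (t - x) `^ mu) t,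
      RL_integrable alpha (fun s : R => s `^ mu) t
    & V_integral gamma beta rho delta p q 0 alpha
        (fun x : R => (t - x) `^ mu) t
      = Gamma (gamma + beta) * Gamma alpha%:C * pochhammer delta p
          / (Gamma beta * pochhammer rho q)
        * RL_integral alpha (fun s : R => s `^ mu) t].
Proof.
have a1 : -1 < alpha - 1 by lra.
have IRL : RL_integrable alpha (fun s : R => s `^ mu) t by exact: integrable_powRM.
(* The reflection at the level of integrands, valid at every real [x]. *)
have V_RL x : V_integrand alpha (fun x => (t - x) `^ mu) x
    = RL_integrand alpha (fun s => s `^ mu) t (t - x).
  by rewrite /V_integrand /RL_integrand subKr mulrC -powRN opprB.
split => //.
  have := integrable_powRM hmu a1 ht; apply: eq_integrable => // x _ /=.
  by rewrite V_RL /RL_integrand subKr mulrC.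
rewrite /V_integral /RL_integral.
have -> : \int[lebesgue_measure]_(x in `]0, t[)
    V_integrand alpha (fun x => (t - x) `^ mu) x
    = \int[lebesgue_measure]_(s in `]0, t[) RL_integrand alpha (fun s => s `^ mu) t s.
  (* The equality is proved between extended-real integrals, where the reflection applies; [powR] is
     nonnegative on the whole line. *)
  congr fine; rewrite [RHS]ge0_integral_reflection; last 2 first.
  - apply/measurable_EFinP/measurable_funM; last exact: measurable_powR.
    apply: (measurableT_comp (measurable_powR (alpha - 1))).
    exact: measurable_funB.
  - by move=> x; rewrite lee_fin mulr_ge0 ?powR_ge0.
  by apply: eq_integral => x _; rewrite V_RL.
have G0 : Gamma alpha%:C != 0.
  have a01 : 0 < alpha <= 1 by rewrite halpha0 ltW.
  by apply: contraTneq (Re_Gamma_gt0 a01) => ->; rewrite ltxx.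
rewrite -!mulrA; congr (_ * _).
rewrite [RHS]mulrCA; congr (_ * _); rewrite [RHS]mulrCA; congr (_ * _).
by rewrite [RHS]mulrCA mulVKf.
Qed.
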